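(* Let $1\le m\le b$ and $n\ge1$. If $A=C_{S_1}\cdots C_{S_n}$ is a juggling card sequence whose $n$ cards are chosen independently and uniformly at random from the set of all cards $C_S$ with $S$ an ordered subset of $[b]$ of size $m$, then the probability that $\pi_A$ is a single cycle of length $b$ is exactly $1/b$ (independent of $n$).
   Context: There are $b$ balls on levels $1,\dots,b$. For an ordered subset $S=(s_1,\dots,s_m)$ of $[b]$ (distinct entries), the card $C_S$ induces the permutation $\pi_{C_S}$ of $[b]$ with $\pi_{C_S}(j)=s_j$ for $1\le j\le m$ and $\pi_{C_S}$ restricted to $\{m+1,\dots,b\}$ the order-preserving bijection onto $[b]\setminus\{s_1,\dots,s_m\}$. For $A=C_{S_1}\cdots C_{S_n}$, $\pi_A=\pi_{C_{S_n}}\circ\cdots\circ\pi_{C_{S_1}}$ (the ball starting at level $j$ ends at level $\pi_A(j)$). *)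

(* Defs.v *)
From HB Require Import structures.
From mathcomp Require Import all_boot all_order all_fingroup all_algebra.
Set Implicit Arguments.
Unset Strict Implicit.
Unset Printing Implicit Defensive.
Import GRing.Theory.

(* Levels 1, ..., b are numbered 0, ..., b-1, i.e. the set of levels is 'I_b. *)

(* The card C_S is identified with the ordered subset S of size m. *)
Definition jcard (b m : nat) : Type := {S : m.-tuple 'I_b | uniq S}.

HB.instance Definition _ b m := Finite.on (jcard b m).

Section CardPermutation.

Variables b m : nat.
Implicit Type C : jcard b m.

(* One-line notation of pi_C: s_1, ..., s_m, followed by the increasing
   enumeration of the levels outside S. *)
Definition jcard_seq C : seq 'I_b :=
  val C ++ [seq x <- enum 'I_b | x \notin val C].

Lemma jcard_seq_uniq C : uniq (jcard_seq C).
Proof.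
rewrite cat_uniq (valP C) filter_uniq ?enum_uniq // andbT /=.
by apply/hasPn => x; rewrite mem_filter => /andP[].
Qed.

Lemma jcard_seq_size C : size (jcard_seq C) == b.
Proof.
rewrite -{2}(card_ord b) cardE; apply/eqP/perm_size/uniq_perm.
- exact: jcard_seq_uniq.
- exact: enum_uniq.
by move=> x; rewrite mem_cat mem_filter mem_enum andbT orbN.
Qed.

Lemma jcard_fun_inj C : injective (tnth (Tuple (jcard_seq_size C))).
Proof. exact/tuple_uniqP/jcard_seq_uniq. Qed.

Definition jcard_perm C : {perm 'I_b} := perm (@jcard_fun_inj C).

Lemma jcard_permE C (j : 'I_b) : jcard_perm C j = nth j (jcard_seq C) j.
Proof. by rewrite permE (tnth_nth j). Qed.

Lemma jcard_perm_lt C (j : 'I_b) (i : 'I_m) :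
  j = i :> nat -> jcard_perm C j = tnth (val C) i.
Proof.
move=> ji; rewrite jcard_permE nth_cat size_tuple ji ltn_ord.
by rewrite (tnth_nth j).
Qed.

Lemma jcard_perm_ge_notin C (j : 'I_b) : m <= j -> jcard_perm C j \notin val C.
Proof.
move=> mj; rewrite jcard_permE nth_cat size_tuple ltnNge mj /=.
have : nth j [seq x <- enum 'I_b | x \notin val C] (j - m)
         \in [seq x <- enum 'I_b | x \notin val C].
  rewrite mem_nth // -(ltn_add2l m) subnKC //.
  by rewrite -{1}(size_tuple (val C)) -size_cat (eqP (jcard_seq_size C)).
by rewrite mem_filter => /andP[].
Qed.

Lemma jcard_perm_ge_incr C (j k : 'I_b) :
  m <= j -> j < k -> jcard_perm C j < jcard_perm C k.
Proof.
move=> mj jk; have mk := leq_trans mj (ltnW jk).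
rewrite !jcard_permE !nth_cat size_tuple !ltnNge mj mk /= -!ltnNge.
set s := [seq x <- _ | _].
have sz : size s = b - m.
  by rewrite -[in RHS](eqP (jcard_seq_size C)) size_cat size_tuple addKn.
have ss : sorted ltn (map val s).
  apply: (subseq_sorted ltn_trans) (iota_ltn_sorted 0 b).
  by rewrite -val_enum_ord map_subseq // filter_subseq.
have jk' : j - m < k - m by rewrite ltn_sub2r // (leq_ltn_trans mj jk).
have km : k - m < size s by rewrite sz ltn_sub2r // (leq_ltn_trans mk).
have jm := ltn_trans jk' km.
have := sorted_ltn_nth ltn_trans 0 ss.
move=> /(_ (j - m) (k - m)); rewrite !inE !size_map => /(_ jm km jk').
by rewrite (nth_map j) // (nth_map k).
Qed.

End CardPermutation.

(* Products in {perm 'I_b} compose from left to right,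
   so this is jcard_perm C_n \o ... \o jcard_perm C_1 for A = C_1 ... C_n. *)
Definition cards_perm b m n (A : n.-tuple (jcard b m)) : {perm 'I_b} :=
  (\prod_(C <- A) jcard_perm C)%g.

Lemma cards_permE b m n (A : n.-tuple (jcard b m)) (j : 'I_b) :
  cards_perm A j = foldl (fun x C => jcard_perm C x) j A.
Proof.
rewrite /cards_perm; case: A => A /= _; elim: A j => [|C A IH] j.
  by rewrite big_nil perm1.
by rewrite big_cons permM IH.
Qed.

Definition is_full_cycle (T : finType) (s : {perm T}) : bool :=
  porbits s == [set [set: T]].

Definition uniform (T : finType) (x : T) : rat := (#|T|%:R^-1)%R.

(* Probability that (X_1, ..., X_n) satisfies E when X_1, ..., X_n are
   independent with common probability mass function mu. *)
Definition iid_prob (T : finType) (mu : T -> rat) (n : nat)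
    (E : pred (n.-tuple T)) : rat :=
  (\sum_(A : n.-tuple T | E A) \prod_(i < n) mu (tnth A i))%R.

(* Main.v *)
(* Averaging.  Reading a card sequence from the last card to the first, every
   card moves m entries of a word to the front; recording the entries moved
   rather than their positions, which is a bijection on card sequences, pi_A
   becomes the card permutation of the duplicate-free list l of all entries
   that were ever moved, in their final order.  This list is nonempty and is
   equivariant under relabelling the entries by g in S_b, so it suffices that,
   for each fixed nonempty l, exactly (b-1)! of the g make the card of g l a
   full cycle.

   Counting.  Let j > 0 be the length of l.  For every full cycle c there is
   exactly one h fixing 0, ..., j-1 such that h c h^-1 is increasing on
   j, ..., b-1: it ranks each x by the time c needs to bring x below j, then by
   the level reached (a case of the Gessel-Reutenauer bijection).  Then c
   corresponds to the g which is c followed by h, whose card permutation is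
   h c h^-1. *)

Require Import Defs.
From mathcomp Require Import all_boot all_order all_fingroup all_algebra.

Import GRing.Theory.

Set Implicit Arguments.
Unset Strict Implicit.
Unset Printing Implicit Defensive.

(** * Full cycles and conjugation *)

Section FullCycles.

Local Open Scope group_scope.

Lemma full_cycleE (T : finType) (s : {perm T}) (x : T) :
  is_full_cycle s = (porbit s x == setT).
Proof.
apply/eqP/eqP => [sT|xT].
  have: porbit s x \in porbits s by rewrite imset_f.
  by rewrite sT => /set1P.
have allT y : porbit s y = setT.
  by rewrite -xT; apply/eqP; rewrite eq_porbit_mem xT inE.
apply/setP => A; rewrite inE; apply/imsetP/eqP => [[y _ ->] //|->].
by exists x.
Qed.

Lemma full_cycle_conj (T : finType) (s g : {perm T}) :
  is_full_cycle (s ^ g) = is_full_cycle s.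
Proof.
have sub (t h : {perm T}) : is_full_cycle t -> is_full_cycle (t ^ h).
  (* On an empty type there are no orbits at all, hence no full cycle. *)
  have [x _|T0] := pickP (@predT T); last first.
    rewrite /is_full_cycle => /eqP/setP/(_ setT); rewrite set11.
    by case/imsetP=> x; have := T0 x.
  rewrite (full_cycleE _ x) (full_cycleE _ (h x)) => /eqP tT.
  apply/eqP/setP => y; rewrite inE.
  have: h^-1 y \in porbit t x by rewrite tT inE.
  by case/porbitP => i hy; apply/porbitP; exists i;
     rewrite -conjXg permJ -hy permKV.
by apply/idP/idP => [/sub-/(_ g^-1)|/sub //]; rewrite conjgK.
Qed.

Variable b : nat.
Implicit Types (s c g h : {perm 'I_b}) (x y z : 'I_b).

Definition full_cycles : {set {perm 'I_b}} := [set c | is_full_cycle c].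

Lemma full_cycle_porbit c x : is_full_cycle c -> porbit c x = setT.
Proof. by rewrite (full_cycleE c x) => /eqP. Qed.

Lemma card_full_cycle_porbit c x : is_full_cycle c -> #|porbit c x| = b.
Proof. by move/full_cycle_porbit->; rewrite cardsT card_ord. Qed.

Lemma mem_traject_full_cycle c x y : is_full_cycle c -> y \in traject c x b.
Proof.
move=> cF; have := porbit_traject c x y.
by rewrite full_cycle_porbit // inE cardsT card_ord => <-.
Qed.

End FullCycles.

(** * The number of full cycles *)

Section CountFullCycles.

Local Open Scope group_scope.

Variable n : nat.

Let rot := perm (@ordS_inj n.+1).

Let iter_rot i : i < n.+1 -> iter i rot ord0 = i :> nat.
Proof.
elim: i => //= i IHi lt_in; rewrite permE /= IHi 1?ltnW //.
by rewrite modn_small.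
Qed.

(** A full cycle with a chosen starting point amounts to the permutation [g] listing its orbit from
    that point; the cycle is then [rot ^ g]. *)
Lemma card_full_cycles : (#|full_cycles n.+1| * n.+1)%N = n.+1`!.
Proof.
have rotX (g : {perm 'I_n.+1}) (i : 'I_n.+1) : g i = ((rot ^ g) ^+ i) (g ord0).
  rewrite -conjXg permJ permX; congr (g _); apply/val_inj.
  by rewrite /= iter_rot.
have rotF : is_full_cycle rot.
  rewrite (full_cycleE _ ord0); apply/eqP/setP => y; rewrite inE.
  by apply/porbitP; exists y; rewrite permX; apply/val_inj; rewrite /= iter_rot.
pose word (g : {perm 'I_n.+1}) := (rot ^ g, g ord0).
rewrite -card_Sn -[X in (_ * X)%N]card_ord -cardsT -cardsX -[RHS]cardsT.
have word_inj : injective word.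
  by move=> g h [eqJ eq0]; apply/permP => i; rewrite rotX [RHS]rotX eqJ eq0.
rewrite -(card_imset _ word_inj); apply: eq_card => -[c x].
rewrite !inE /= andbT; apply/idP/imsetP => [cF|[g _ [-> _]]]; last first.
  by rewrite full_cycle_conj.
have g_inj : injective (fun i : 'I_n.+1 => iter i c x).
  move=> i k; have := uniq_traject_porbit c x.
  rewrite card_full_cycle_porbit // => Ut eq_ik; apply/val_inj/eqP.
  rewrite -(nth_uniq x _ _ Ut) ?size_traject ?ltn_ord //.
  by rewrite !nth_traject ?eq_ik ?ltn_ord.
exists (perm g_inj); rewrite ?inE // /word permE /=; congr (_, _).
apply/permP => y; rewrite -[y](permKV (perm g_inj)) permJ.
move: (fun_of_perm _ y) => i; rewrite !permE /=.
(* At the last index the successor wraps around to 0, just as the orbit closes after [n.+1]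
   steps. *)
have := ltn_ord i; rewrite ltnS leq_eqVlt => /orP[/eqP->|lt_in].
  have := iter_porbit c x; rewrite card_full_cycle_porbit //= => ->.
  by rewrite modnn.
by rewrite modn_small.
Qed.

End CountFullCycles.

(** * Ranking points by an injective key *)

Section RankPermutation.

Variable b : nat.
Implicit Types (h : {perm 'I_b}) (f : 'I_b -> nat).

Definition sorts f h := [forall x, forall y, (h x < h y) == (f x < f y)].

Lemma sortsP f h :
  reflect (forall x y, (h x < h y) = (f x < f y)) (sorts f h).
Proof. exact: 'forall_'forall_eqP. Qed.

Definition rank_perm f := odflt 1%g [pick h | sorts f h].

(** Counting the points of smaller key gives a sorting permutation, so the default [1] in
    [rank_perm] is not reached. *)
Lemma rank_permP f : injective f -> sorts f (rank_perm f).
Proof.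
move=> f_inj; rewrite /rank_perm; case: pickP => //= noh.
pose r x := #|[set y | f y < f x]|.
have r_lt x : r x < b.
  rewrite -[X in _ < X]card_ord -cardsT; apply/proper_card/properP.
  by split; [apply: subsetT | exists x; rewrite ?inE // ltnn].
have r_mono x y : f x < f y -> r x < r y.
  move=> xy; apply/proper_card/properP; split.
    by apply/subsetP => z; rewrite !inE => /ltn_trans; apply.
  by exists x; rewrite !inE // ltnn.
pose R x := Ordinal (r_lt x).
have R_inj : injective R.
  move=> x y /(congr1 val) /= rxy; apply: f_inj.
  have [xy|yx|//] := ltngtP (f x) (f y).
    by have := r_mono _ _ xy; rewrite rxy ltnn.
  by have := r_mono _ _ yx; rewrite rxy ltnn.
have /sortsP[] := negbT (noh (perm R_inj)) => x y; rewrite !permE /=.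
apply/idP/idP => [|/r_mono //]; apply: contraLR; rewrite -!leqNgt => fyx.
by apply/subset_leq_card/subsetP => z; rewrite !inE => /leq_trans; apply.
Qed.

(** [h] maps the points of smaller key onto the levels below [h x]; this forces the value of [h]. *)
Lemma sorts_card f h x : sorts f h -> h x = #|[set y | f y < f x]| :> nat.
Proof.
move/sortsP=> hf; have lt_x : #|[set z : 'I_b | z < h x]| = h x.
  rewrite -[RHS](card_ord (h x)) -cardsT.
  have le_xb := ltnW (ltn_ord (h x)).
  have wid_inj : injective (widen_ord le_xb).
    by move=> i k /(congr1 val) /= /val_inj.
  rewrite -(card_imset _ wid_inj); apply: eq_card => z.
  rewrite inE; apply/idP/imsetP => [lt_z|[k _ ->]] //=.
  by exists (Ordinal lt_z) => //; apply/val_inj.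
rewrite -lt_x -[RHS](card_imset _ (@perm_inj _ h)); apply: eq_card => z.
rewrite inE; apply/idP/imsetP => [lt_z|[y]]; last by rewrite inE -hf => ? ->.
by exists ((h^-1)%g z); rewrite ?inE -?hf permKV.
Qed.

Lemma sorts_unique f h h' : sorts f h -> sorts f h' -> h = h'.
Proof.
move=> hf h'f; apply/permP => x; apply/val_inj.
by rewrite /= (sorts_card _ hf) (sorts_card _ h'f).
Qed.

End RankPermutation.

(** * Making a full cycle increasing from level [j] on by conjugation *)

Section TailSorting.

Local Open Scope group_scope.

Variables b j : nat.
Hypothesis j_gt0 : 0 < j.
Implicit Types (c g h s : {perm 'I_b}) (x y z : 'I_b).

Definition tail_increasing s :=
  forall x y, j <= x -> x < y -> s x < s y.

(** A full cycle visits level 0, which is below [j], within the first [b] points, so for such [c]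
    the search succeeds. *)
Definition head_time c x := find (fun y : 'I_b => y < j) (traject c x b).

(* Orders the pairs (time, level reached) lexicographically: levels are < b. *)
Definition head_key c x := head_time c x * b + iter (head_time c x) c x.

Lemma head_key_lt c x : x < j -> head_key c x = x.
Proof.
rewrite /head_key /head_time; case: b c x => [|n] c x; first by case: x.
by rewrite /= => ->.
Qed.

(** From [x >= j], one step of [c] shortens the time by one and keeps the level reached. *)
Lemma head_key_ge c x :
  is_full_cycle c -> j <= x -> head_key c x = head_key c (c x) + b.
Proof.
move=> cF le_jx; have b_gt0 : 0 < b by apply: leq_trans (ltn_ord x).
suff tx : head_time c x = (head_time c (c x)).+1.
  by rewrite /head_key tx iterSr mulSn addnC addnA addnC addnA.
have := mem_traject_full_cycle x (Ordinal b_gt0) cF.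
rewrite /head_time; case: b b_gt0 c x le_jx {cF} => // n b_gt0 c x le_jx.
(* The trajectories from [x] and from [c x] share all but one end point each; level 0 is in the
   shared part because [x >= j > 0], so both searches stop there. *)
rewrite trajectS trajectSr inE -cats1 find_cat -val_eqE /= ltnNge le_jx /=.
move=> /orP[/eqP x0|mem0]; first by rewrite -x0 leqNgt j_gt0 in le_jx.
by rewrite ifT //; apply/hasP; exists (Ordinal b_gt0).
Qed.

Lemma ltn_head_key c x :
  is_full_cycle c -> j <= x -> head_key c (c x) < head_key c x.
Proof.
move=> cF le_jx; rewrite [ltnRHS]head_key_ge // -[ltnLHS]addn0 ltn_add2l.
by apply: leq_ltn_trans (ltn_ord x).
Qed.

Lemma head_key_ltb c x : is_full_cycle c -> (head_key c x < b) = (x < j).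
Proof.
move=> cF; have [lt_xj|le_jx] := ltnP x j.
  by rewrite head_key_lt ?ltn_ord.
by rewrite head_key_ge // ltnNge leq_addl.
Qed.

Lemma head_key_ltn c x y : is_full_cycle c -> x < j ->
  (head_key c y < head_key c x) = (y < x).
Proof.
move=> cF lt_xj; rewrite [head_key c x]head_key_lt //.
have [lt_yj|le_jy] := ltnP y j; first by rewrite head_key_lt.
rewrite head_key_ge // [RHS]ltnNge (leq_trans (ltnW lt_xj) le_jy).
apply/negbTE; rewrite -leqNgt (leq_trans (ltnW (ltn_ord x))) //.
exact: leq_addl.
Qed.

(** Below [j] the key is the level itself; from [j] on, cancel [b] and pass to the images under [c],
    whose keys are smaller. *)
Lemma head_key_inj c : is_full_cycle c -> injective (head_key c).
Proof.
move=> cF x y; have [k] := ubnP (head_key c x); elim: k x y => // k IHk x y.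
rewrite ltnS => le_xk kxy.
have := head_key_ltb x cF; rewrite kxy head_key_ltb //.
have [lt_xj|le_jx] := ltnP x j => lt_yj.
  by apply/val_inj; move: kxy; rewrite !head_key_lt.
have le_jy : j <= y by rewrite leqNgt lt_yj.
apply/(@perm_inj _ c)/IHk; first exact: leq_trans (ltn_head_key cF le_jx) le_xk.
by move: kxy; rewrite [LHS]head_key_ge // [RHS]head_key_ge // => /addIn.
Qed.

Lemma head_key_mono c x y : is_full_cycle c -> j <= x -> j <= y ->
  (head_key c (c x) < head_key c (c y)) = (head_key c x < head_key c y).
Proof.
move=> cF ? ?; rewrite [head_key c x]head_key_ge //.
by rewrite [head_key c y]head_key_ge // ltn_add2r.
Qed.

(** Exactly the levels below [x] have a smaller key, so the rank of [x] is [x]. *)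
Lemma sorts_head_fix c h x :
  is_full_cycle c -> sorts (head_key c) h -> x < j -> h x = x.
Proof.
move=> cF hc lt_xj; apply/val_inj; rewrite /= (sorts_card _ hc).
have <- : #|[set y : 'I_b | y < x]| = x.
  have := @sorts_card b (@nat_of_ord b) 1 x; rewrite perm1 => <- //.
  by apply/sortsP => y z; rewrite !perm1.
by apply: eq_card => y; rewrite !inE head_key_ltn.
Qed.

Lemma head_fix_ltn h : (forall x, x < j -> h x = x) ->
  forall x, (h x < j) = (x < j).
Proof.
move=> hfix x; apply/idP/idP => [lt_hx|lt_x]; last by rewrite hfix.
by rewrite -(@perm_inj _ h _ _ (hfix _ lt_hx)).
Qed.

(** [h] carries the path of [x] under [c] to that of [h x] under [c ^ h]; both first drop below [j]
    at the same time and at the same level, fixed by [h]. *)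
Lemma head_key_conj c h x : is_full_cycle c -> (forall y, y < j -> h y = y) ->
  head_key (c ^ h) (h x) = head_key c x.
Proof.
move=> cF hfix; have chF : is_full_cycle (c ^ h) by rewrite full_cycle_conj.
have [k] := ubnP (head_key c x); elim: k x => // k IHk x.
rewrite ltnS => le_xk; have [lt_xj|le_jx] := ltnP x j.
  by rewrite hfix // !head_key_lt.
have le_jhx : j <= h x by rewrite leqNgt head_fix_ltn // -leqNgt.
rewrite (head_key_ge chF) // (head_key_ge cF) // permJ IHk //.
exact: leq_trans (ltn_head_key cF le_jx) le_xk.
Qed.

(** From [j] on, [c] lowers every key by [b], so it preserves key order, which [h] turns into level
    order. *)
Lemma sorts_tail_increasing c h : is_full_cycle c -> sorts (head_key c) h ->
  tail_increasing (c ^ h).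
Proof.
move=> cF hc u v; rewrite -[u](permKV h) -[v](permKV h) !permJ.
move: (fun_of_perm _ u) (fun_of_perm _ v) => x y le_jx lt_xy.
have hfix z : z < j -> h z = z by apply: sorts_head_fix hc.
have hge z : j <= h z -> j <= z by rewrite !(leqNgt j) head_fix_ltn.
have le_jx' := hge x le_jx.
have le_jy' : j <= y by apply/hge/(leq_trans le_jx)/ltnW.
by rewrite (sortsP _ _ hc) head_key_mono // -(sortsP _ _ hc).
Qed.

(** For two points from [j] on, a step of [s] preserves their order and lowers both keys by [b], so
    induction on the key applies. *)
Lemma tail_increasing_sorts s : is_full_cycle s -> tail_increasing s ->
  sorts (head_key s) 1.
Proof.
move=> sF s_incr.
have mono x y : x < y -> head_key s x < head_key s y.
  have [k] := ubnP (head_key s y); elim: k x y => // k IHk x y.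
  rewrite ltnS => le_yk lt_xy; have [lt_yj|le_jy] := ltnP y j.
    by rewrite head_key_ltn.
  have [lt_xj|le_jx] := ltnP x j.
    rewrite head_key_lt // head_key_ge // (leq_trans (ltn_ord x)) //.
    exact: leq_addl.
  rewrite -head_key_mono //; apply: IHk; last exact: s_incr.
  exact: leq_trans (ltn_head_key sF le_jy) le_yk.
apply/sortsP => x y; rewrite !perm1; apply/idP/idP => [/mono //|].
apply: contraLR; rewrite -!leqNgt leq_eqVlt => /orP[/eqP/val_inj-> //|/mono].
exact: ltnW.
Qed.

(** This gives uniqueness of [h]: level order agrees with key order for [c ^ h], and [h] transports
    the keys of [c] to those of [c ^ h]. *)
Lemma sorts_conj c h : is_full_cycle c -> (forall x, x < j -> h x = x) ->
  tail_increasing (c ^ h) -> sorts (head_key c) h.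
Proof.
move=> cF hfix c_incr.
have /tail_increasing_sorts/(_ c_incr)/sortsP srt : is_full_cycle (c ^ h).
  by rewrite full_cycle_conj.
apply/sortsP => x y; rewrite -!(head_key_conj _ cF hfix).
by have := srt (h x) (h y); rewrite !perm1.
Qed.

(** The hypotheses make [F g] the only tail-increasing permutation agreeing with [g] below [j]. The
    bijection from full cycles is [G]. *)
Lemma card_tail_sorted_full_cycles (F : {perm 'I_b} -> {perm 'I_b}) :
    (forall g x, x < j -> F g x = g x) ->
    (forall g, tail_increasing (F g)) ->
    (forall g s, (forall x, x < j -> s x = g x) -> tail_increasing s ->
       F g = s) ->
  #|[set g | is_full_cycle (F g)]| = #|full_cycles b|.
Proof.
move=> F_head F_tail F_uniq.
pose rk c := rank_perm (head_key c); pose G c := c * rk c.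
have rk_srt c : is_full_cycle c -> sorts (head_key c) (rk c).
  by move/head_key_inj; apply: rank_permP.
have rk_fix c x : is_full_cycle c -> x < j -> rk c x = x.
  by move=> cF; apply: sorts_head_fix (rk_srt c cF).
have FG c : is_full_cycle c -> F (G c) = c ^ rk c.
  move=> cF; apply: F_uniq => [x lt_xj|].
    by rewrite -{1}(rk_fix c x) // permJ permM.
  by apply: sorts_tail_increasing (rk_srt c cF).
(* Since [F (G c) = (rk c)^-1 * G c], the value [G c] determines [rk c], and then [c]. *)
have G_inj : {in full_cycles b &, injective G}.
  move=> c c'; rewrite !inE => cF c'F eqG.
  have := congr1 F eqG; rewrite !FG // !conjgE -/(G c) -/(G c') eqG.
  by move/mulIg/invg_inj => eq_rk; move: eqG; rewrite /G eq_rk => /mulIg.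
rewrite -(card_in_imset G_inj); apply: eq_card => g; rewrite inE.
apply/idP/imsetP => [FgF|[c]]; last first.
  by rewrite inE => cF ->; rewrite FG ?full_cycle_conj.
(* A preimage [c] of [g] must satisfy [c ^ h = F g] and [c * h = g] with [h = rk c]; this forces
   [h * F g = g]. *)
pose h := g * (F g)^-1; have hfix x : x < j -> h x = x.
  by move=> lt_xj; rewrite permM -(F_head g) // permK.
pose c := F g ^ h^-1; have ch : c ^ h = F g by rewrite conjgKV.
have cF : is_full_cycle c by rewrite full_cycle_conj.
exists c; rewrite ?inE // /G.
have -> : rk c = h.
  by apply: sorts_unique (rk_srt c cF) _; apply: sorts_conj; rewrite ?ch.
by rewrite conjgC ch mulgKV.
Qed.

End TailSorting.

(** * Card permutations of duplicate-free lists *)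

Section FrontPermutation.

Local Open Scope group_scope.

Variable b : nat.
Implicit Types (l T : seq 'I_b) (g s u v : {perm 'I_b}) (x y : 'I_b).

(* [undup] makes the definition total; only duplicate-free lists matter. *)
Definition front_card l : jcard b (size (undup l)) :=
  exist _ (in_tuple (undup l)) (undup_uniq l).

Definition front_perm l : {perm 'I_b} := jcard_perm (front_card l).

Lemma eq_perm_word u v :
  [seq u x | x <- enum 'I_b] = [seq v x | x <- enum 'I_b] -> u = v.
Proof.
by move/eq_in_map => uv; apply/permP => x; apply: uv; rewrite mem_enum.
Qed.

Lemma jcard_perm_word m (C : jcard b m) :
  [seq jcard_perm C x | x <- enum 'I_b] = jcard_seq C.
Proof.
rewrite -[RHS](map_tnth_enum (Tuple (jcard_seq_size C))).
by apply: eq_map => x; rewrite permE.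
Qed.

Lemma front_perm_word l : uniq l ->
  [seq front_perm l x | x <- enum 'I_b]
    = l ++ [seq x <- enum 'I_b | x \notin l].
Proof. by move=> Ul; rewrite jcard_perm_word /jcard_seq /= undup_id. Qed.

Lemma front_permE l x : uniq l ->
  front_perm l x = nth x (l ++ [seq y <- enum 'I_b | y \notin l]) x.
Proof.
move=> Ul; rewrite -front_perm_word // (nth_map x) ?size_enum_ord //.
by rewrite nth_ord_enum.
Qed.

Lemma front_perm_tail_increasing l : tail_increasing (size l) (front_perm l).
Proof.
by move=> x y le_lx; apply/jcard_perm_ge_incr/(leq_trans (size_undup l)).
Qed.

(** Move-to-front update; entries of [T] may be new to [l]. *)
Definition to_front T l := T ++ [seq x <- l | x \notin T].

Lemma to_front_uniq T l : uniq T -> uniq l -> uniq (to_front T l).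
Proof.
move=> UT Ul; rewrite cat_uniq UT filter_uniq // andbT.
by apply/hasPn => x; rewrite mem_filter => /andP[].
Qed.

Lemma map_to_front g T l : map g (to_front T l) = to_front (map g T) (map g l).
Proof.
rewrite /to_front map_cat filter_map; congr (_ ++ map _ _).
by apply: eq_filter => x /=; rewrite mem_map //; apply: perm_inj.
Qed.

(** Multiplying by the card on the left permutes the positions of the word of [front_perm l]: the
    entries at the positions in [C] come first, the others keep their order. *)
Lemma jcard_perm_mul_front m (C : jcard b m) l : uniq l ->
  jcard_perm C * front_perm l
    = front_perm (to_front (map (front_perm l) (val C)) l).
Proof.
move=> Ul; set u := front_perm l; set T := map u _.
have UT : uniq T by rewrite map_inj_uniq ?(valP C) //; apply: perm_inj.
apply: eq_perm_word; rewrite front_perm_word ?to_front_uniq //.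
rewrite (eq_map (permM _ _)) map_comp jcard_perm_word.
rewrite -/(to_front _ _) map_to_front -/T front_perm_word //.
rewrite /to_front filter_cat catA; congr (_ ++ _).
rewrite -filter_predI; apply: eq_filter => x /=.
by rewrite mem_cat mem_filter negb_or; case: (x \in T).
Qed.

Section HeadMap.

Variable j : nat.
Hypothesis le_jb : j <= b.

Definition heads := take j (enum 'I_b).

Lemma size_heads : size heads = j.
Proof. by rewrite size_take_min size_enum_ord (minn_idPl le_jb). Qed.

Lemma mem_heads x : (x \in heads) = (x < j).
Proof.
rewrite -(mem_map val_inj) map_take val_enum_ord take_iota.
by rewrite (minn_idPl le_jb) mem_iota.
Qed.

Lemma mem_drop_enum x : (x \in drop j (enum 'I_b)) = (j <= x).
Proof.
rewrite -(mem_map val_inj) map_drop val_enum_ord drop_iota mem_iota.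
by rewrite subnKC // ltn_ord andbT.
Qed.

Lemma front_perm_head g x : x < j -> front_perm (map g heads) x = g x.
Proof.
move=> lt_xj.
have Ug : uniq (map g heads).
  by rewrite map_inj_uniq ?take_uniq ?enum_uniq //; apply: perm_inj.
rewrite front_permE // nth_cat size_map size_heads lt_xj (nth_map x).
  by rewrite nth_take // nth_ord_enum.
by rewrite size_heads.
Qed.

Lemma front_perm_unique g s :
    (forall x, x < j -> s x = g x) -> tail_increasing j s ->
  front_perm (map g heads) = s.
Proof.
move=> s_head s_tail; apply: eq_perm_word.
have Ug : uniq (map g heads).
  by rewrite map_inj_uniq ?take_uniq ?enum_uniq //; apply: perm_inj.
have sg : map s heads = map g heads.
  by apply/eq_in_map => x; rewrite mem_heads; apply: s_head.
rewrite front_perm_word // -sg -[in RHS](cat_take_drop j (enum 'I_b)) map_cat.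
congr (_ ++ _); pose lto := relpre (@nat_of_ord b) ltn.
have sort_enum : sorted lto (enum 'I_b).
  by rewrite -sorted_map val_enum_ord iota_ltn_sorted.
have lto_tr : transitive lto by move=> y x z; apply: ltn_trans.
(* Both lists are strictly increasing with the same members, hence equal. *)
apply: (irr_sorted_eq lto_tr) => [x|||x]; first exact: ltnn.
- exact: sorted_filter.
- rewrite sorted_map; apply: (@sub_in_sorted _ (fun x => j <= x) lto).
  + by move=> x y /= le_jx _; apply: s_tail.
  + by apply/allP => x; rewrite mem_drop_enum.
  exact: drop_sorted.
rewrite mem_filter mem_enum andbT -[x](permKV s) !(mem_map (@perm_inj _ s)).
by rewrite mem_heads mem_drop_enum -leqNgt.
Qed.

End HeadMap.

(** The list [l] is the image of the first [j] levels under [u], so left translation by [u] reduces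
    the count to that initial segment. *)
Lemma card_front_full_cycles l : uniq l -> l != [::] ->
  #|[set g : {perm 'I_b} | is_full_cycle (front_perm (map g l))]|
    = #|full_cycles b|.
Proof.
move=> Ul l_neq0; pose j := size l; pose u := front_perm l.
have j_gt0 : 0 < j by rewrite lt0n size_eq0.
have le_jb : j <= b.
  by have := max_card [in l]; rewrite (card_uniqP Ul) card_ord.
have lE : l = map u (heads j).
  by rewrite /heads map_take front_perm_word // take_size_cat.
pose F g := front_perm (map g (heads j)).
have FE : (forall g x, x < j -> F g x = g x) /\
          (forall g, tail_increasing j (F g)).
  split=> g; first by move=> x; apply: front_perm_head.
  have := @front_perm_tail_increasing (map g (heads j)).
  by rewrite size_map size_heads.
rewrite -(card_tail_sorted_full_cycles j_gt0 FE.1 FE.2); last first.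
  by move=> g s; apply: front_perm_unique.
rewrite -[RHS](card_preimset _ (mulgI u)); apply: eq_card => g.
rewrite !inE /F {1}lE -map_comp; congr (is_full_cycle (front_perm _)).
by apply: eq_map => x; rewrite permM.
Qed.

End FrontPermutation.

(** * Averaging over card sequences *)

Lemma sum_tuple_cons (T : finType) (n : nat) (F : n.+1.-tuple T -> nat) :
  \sum_(A : n.+1.-tuple T) F A
    = \sum_(x : T) \sum_(A : n.-tuple T) F [tuple of x :: A].
Proof.
rewrite pair_bigA /=.
rewrite (reindex (fun p : T * n.-tuple T => cons_tuple p.1 p.2)) //.
exists (fun A : n.+1.-tuple T => (thead A, behead_tuple A)) => [[x A] _|A _] /=.
  by rewrite theadE; congr (_, _); apply/val_inj.
by rewrite [RHS]tuple_eta; apply/val_inj.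
Qed.

Section RandomCards.

Local Open Scope group_scope.

Variables b m : nat.
Implicit Types (C : jcard b m) (g u : {perm 'I_b}) (A : seq (jcard b m)).

Lemma relabel_subproof g C : uniq (map_tuple g (val C)).
Proof. by rewrite map_inj_uniq ?(valP C) //; apply: perm_inj. Qed.

Definition relabel g C : jcard b m :=
  exist _ (map_tuple g (val C)) (relabel_subproof g C).

Lemma relabelK g : cancel (relabel g) (relabel g^-1).
Proof.
move=> C; do 2 apply/val_inj; rewrite /= -map_comp map_id_in // => x _ /=.
exact: permK.
Qed.

Lemma relabel_bij g : bijective (relabel g).
Proof.
exists (relabel g^-1); first exact: relabelK.
by rewrite -{2}[g]invgK; apply: relabelK.
Qed.

(** Folding from the right lets the last card act first and the first card end up in front. *)
Definition touched A := foldr (fun C l => to_front (val C) l) [::] A.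

Lemma touched_uniq A : uniq (touched A).
Proof. by elim: A => //= C A; apply/to_front_uniq/(valP C). Qed.

Lemma touched_relabel g A : touched (map (relabel g) A) = map g (touched A).
Proof. by elim: A => //= C A ->; rewrite map_to_front. Qed.

Lemma touched_neq0 n (A : n.-tuple (jcard b m)) :
  0 < m -> 0 < n -> touched A != [::].
Proof.
move=> m_gt0; case: n A => // n A _; rewrite (tuple_eta A) /= -size_eq0.
by rewrite size_cat size_tuple addn_eq0 negb_and -lt0n m_gt0.
Qed.

Lemma front_perm_nil : front_perm [::] = 1 :> {perm 'I_b}.
Proof.
apply: eq_perm_word; rewrite front_perm_word // (eq_map (@perm1 _)) map_id.
exact: filter_predT.
Qed.

Lemma sum_cards_perm n (F : {perm 'I_b} -> nat) :
  \sum_(A : n.-tuple (jcard b m)) F (cards_perm A)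
    = \sum_(A : n.-tuple (jcard b m)) F (front_perm (touched A)).
Proof.
elim: n F => [|n IHn] F.
  by apply: eq_bigr => A _; rewrite tuple0 /cards_perm big_nil front_perm_nil.
rewrite !sum_tuple_cons.
transitivity (\sum_(C : jcard b m) \sum_(A : n.-tuple (jcard b m))
                F (jcard_perm C * front_perm (touched A))%g).
  (* Induction is used with [F] precomposed with left multiplication by the first card. *)
  apply: eq_bigr => C _; rewrite -(IHn (fun u => F (jcard_perm C * u)%g)).
  by apply: eq_bigr => A _; rewrite /cards_perm big_cons.
(* The relabelling that turns positions into entries depends on the tail [A]; with [A] fixed it is a
   bijection on first cards. *)
rewrite exchange_big [RHS]exchange_big; apply: eq_bigr => A _ /=.
rewrite [RHS](reindex _ (onW_bij _ (relabel_bij (front_perm (touched A))))).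
by apply: eq_bigr => C _; rewrite jcard_perm_mul_front ?touched_uniq.
Qed.

Lemma sum_relabel n g (F : seq (jcard b m) -> nat) :
  \sum_(A : n.-tuple (jcard b m)) F (map (relabel g) A)
    = \sum_(A : n.-tuple (jcard b m)) F A.
Proof.
have [r rK Kr] := relabel_bij g.
rewrite [RHS](reindex (map_tuple (relabel g))) //.
by exists (map_tuple r) => A _; apply/val_inj;
   rewrite /= -map_comp map_id_in // => C _ /=.
Qed.

Lemma card_full_cycle_cards n : 0 < m -> 0 < n -> 0 < b ->
  (#|[set A : n.-tuple (jcard b m) | is_full_cycle (cards_perm A)]| * b)%N
    = (#|{: jcard b m}| ^ n)%N.
Proof.
move=> m_gt0 n_gt0 b_gt0; set N := #|_|.
have cF : (#|full_cycles b| * b)%N = b`!.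
  by case: b b_gt0 => // k _; apply: card_full_cycles.
(* The factor [b!] becomes a sum over all relabellings [g], which replaces averaging by counting. *)
apply/eqP; rewrite -(eqn_pmul2l (fact_gt0 b)); apply/eqP.
have NE : N = \sum_(A : n.-tuple (jcard b m))
                (is_full_cycle (front_perm (touched A)) : nat).
  rewrite -(sum_cards_perm n (fun u => is_full_cycle u)).
  rewrite /N -sum1_card big_mkcond.
  by apply: eq_bigr => A _; rewrite inE; case: is_full_cycle.
have -> : (b`! * (N * b) = (\sum_(g : {perm 'I_b}) N) * b)%N.
  by rewrite sum_nat_const card_Sn mulnA.
rewrite -card_tuple -cF [RHS]mulnC mulnA; congr (_ * _)%N.
transitivity (\sum_(g : {perm 'I_b}) \sum_(A : n.-tuple (jcard b m))
                (is_full_cycle (front_perm (map g (touched A))) : nat)).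
  apply: eq_bigr => g _; rewrite NE.
  rewrite -(sum_relabel n g (fun A => is_full_cycle (front_perm (touched A)))).
  by apply: eq_bigr => A _; rewrite touched_relabel.
(* For each fixed sequence the number of suitable [g] is the number of full cycles. *)
rewrite exchange_big -sum_nat_const; apply: eq_bigr => A _ /=.
rewrite -(card_front_full_cycles (touched_uniq A) (touched_neq0 _ m_gt0 n_gt0)).
rewrite -sum1_card [RHS]big_mkcond.
by apply: eq_bigr => g _; rewrite inE; case: is_full_cycle.
Qed.

Lemma card_jcard_gt0 : m <= b -> 0 < #|{: jcard b m}|.
Proof.
move=> le_mb; apply/card_gt0P.
have sz : size (heads b m) == m by rewrite size_heads.
by exists (exist _ (Tuple sz) (take_uniq _ (enum_uniq _))).
Qed.

End RandomCards.

(** * From counts to the probability *)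

Theorem theorem6p4 (b m n : nat) (m_ge1 : 1 <= m) (m_le_b : m <= b)
    (n_ge1 : 1 <= n) :
  iid_prob (@uniform (jcard b m))
    (fun A : n.-tuple (jcard b m) => is_full_cycle (cards_perm A))
  = (b%:R^-1)%R.
Proof.
have b_gt0 : 0 < b by apply: leq_trans m_le_b.
have nz k : 0 < k -> (k%:R != 0 :> rat)%R by rewrite Num.Theory.pnatr_eq0 lt0n.
set N := #|[set A : n.-tuple (jcard b m) | is_full_cycle (cards_perm A)]|.
have NE := card_full_cycle_cards m_ge1 n_ge1 b_gt0; rewrite -/N in NE.
transitivity (N%:R * (#|{: jcard b m}| ^ n)%:R^-1 : rat)%R.
  rewrite /iid_prob /uniform mulr_natl -[RHS]sumr_const.
  apply: eq_big => [A|A _]; first by rewrite inE.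
  by rewrite prodr_const card_ord natrX exprVn.
(* [N * b] is the number of card sequences, positive because a card exists when [m <= b]; so [N]
   cancels in [N / (N * b)]. *)
have N_gt0 : 0 < N.
  by rewrite lt0n; apply/eqP => N0; move/eqP: NE;
     rewrite N0 mul0n eq_sym expn_eq0 eqn0Ngt card_jcard_gt0.
by rewrite -NE natrM invfM mulrA divff ?mul1r // nz.
Qed.
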